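(* Let $W$ be a finite Weyl group with simple reflections $s_1,\dots,s_n$. There is an isomorphism of superalgebras $$\ddot\Phi:\ \mathcal C_{\mathfrak h^*\oplus\mathfrak h}\rtimes\mathbb C W\ \xrightarrow{\ \simeq\ }\ \mathcal C_{\mathfrak h^*\oplus\mathfrak h}\otimes\mathbb C W$$ which extends the identity map on $\mathcal C_{\mathfrak h^*\oplus\mathfrak h}$ and sends $s_i\mapsto\sqrt{-1}\,\beta_i\nu_i s_i$ for each $i$. The inverse map $\ddot\Psi$ is the extension of the identity map on $\mathcal C_{\mathfrak h^*\oplus\mathfrak h}$ which sends $s_i\mapsto\sqrt{-1}\,\beta_i\nu_i s_i$ for each $i$.
   Context: All algebras are over $\mathbb C$. A superalgebra is a $\mathbb Z_2$-graded algebra. $W$ is a finite Weyl group (of a complex simple Lie algebra, or of $gl_n$ in type $A_{n-1}$) with simple reflections $s_1,\dots,s_n$ and Coxeter relations $(s_is_j)^{m_{ij}}=1$. $\mathfrak h$ is the reflection representation (in type $A_{n-1}$ take $\mathfrak h=\mathbb C^n$), and $(-,-)$ is the standard $W$-invariant nondegenerate symmetric bilinear form on $\mathfrak h^*$ (restricted from the standard form on some $\mathbb C^N$); it induces an identification $\mathfrak h\cong\mathfrak h^*$ and a form on $\mathfrak h$, also denoted $(-,-)$. $\mathcal C_{\mathfrak h^*\oplus\mathfrak h}$ is the Clifford algebra of the orthogonal direct sum of $(\mathfrak h^*,(-,-))$ and $(\mathfrak h,(-,-))$: it is generated by $\mathfrak h^*\oplus\mathfrak h$ with $ab+ba=(a,b)$,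 where elements of $\mathfrak h^*$ anticommute with elements of $\mathfrak h$. $W$ acts on it by automorphisms $a\mapsto a^w$ extending the diagonal action on $\mathfrak h^*\oplus\mathfrak h$. $\beta_i\in\mathfrak h^*$ is the simple root $\alpha_i$ rescaled by a positive scalar so that $\beta_i^2=1$ in the Clifford algebra (so $(\beta_i,\beta_i)=2$), and $\nu_i\in\mathfrak h$ is the counterpart of $\beta_i$ under $\mathfrak h\cong\mathfrak h^*$. $\mathcal C_{\mathfrak h^*\oplus\mathfrak h}\rtimes\mathbb C W$ is the semidirect (smash) product, with $wa=a^ww$. In both algebras of the theorem the elements of $\mathfrak h^*\oplus\mathfrak h$ are odd and the elements of $W$ are even; in $\mathcal C_{\mathfrak h^*\oplus\mathfrak h}\otimes\mathbb C W$ the two factors commute. *)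

(* Defs.v *)
From HB Require Import structures.
From mathcomp Require Import all_boot all_order all_fingroup all_algebra.
From mathcomp Require Import complex.
From mathcomp Require Import boolp reals.
From mathcomp Require Import ring.
(* Imported last: the [repr] of fingroup hides that of generic_quotient. *)
From mathcomp Require Import generic_quotient.

Set Implicit Arguments.
Unset Strict Implicit.
Unset Printing Implicit Defensive.

Import Order.TTheory GRing.Theory Num.Theory.

Local Open Scope ring_scope.
Local Open Scope quotient_scope.

Section CliffordTerms.
Variables (F : numFieldType) (V : vectType F) (B : {symmetric V}).

Inductive cliff_term : Type :=
  | CGen of V
  | CConst of F
  | CAdd of cliff_term & cliff_term
  | CMul of cliff_term & cliff_term.

(* The congruence presenting the unital associative F-algebra generated by
   the vector space V subject to v w + w v = B v w. *)
Inductive cliff_eq : cliff_term -> cliff_term -> Prop :=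
  | ce_refl x : cliff_eq x x
  | ce_sym x y : cliff_eq x y -> cliff_eq y x
  | ce_trans x y z : cliff_eq x y -> cliff_eq y z -> cliff_eq x z
  | ce_add x x' y y' :
      cliff_eq x x' -> cliff_eq y y' -> cliff_eq (CAdd x y) (CAdd x' y')
  | ce_mul x x' y y' :
      cliff_eq x x' -> cliff_eq y y' -> cliff_eq (CMul x y) (CMul x' y')
  | ce_addA x y z : cliff_eq (CAdd x (CAdd y z)) (CAdd (CAdd x y) z)
  | ce_addC x y : cliff_eq (CAdd x y) (CAdd y x)
  | ce_add0 x : cliff_eq (CAdd (CConst 0) x) x
  | ce_addN x : cliff_eq (CAdd (CMul (CConst (-1)) x) x) (CConst 0)
  | ce_mulA x y z : cliff_eq (CMul x (CMul y z)) (CMul (CMul x y) z)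
  | ce_mul1 x : cliff_eq (CMul (CConst 1) x) x
  | ce_mulDl x y z :
      cliff_eq (CMul (CAdd x y) z) (CAdd (CMul x z) (CMul y z))
  | ce_mulDr x y z :
      cliff_eq (CMul x (CAdd y z)) (CAdd (CMul x y) (CMul x z))
  | ce_constD a b : cliff_eq (CConst (a + b)) (CAdd (CConst a) (CConst b))
  | ce_constM a b : cliff_eq (CConst (a * b)) (CMul (CConst a) (CConst b))
  | ce_constC a x : cliff_eq (CMul (CConst a) x) (CMul x (CConst a))
  | ce_genP a v w :
      cliff_eq (CGen (a *: v + w)) (CAdd (CMul (CConst a) (CGen v)) (CGen w))
  | ce_cliff v w :
      cliff_eq (CAdd (CMul (CGen v) (CGen w)) (CMul (CGen w) (CGen v)))
               (CConst (B v w)).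

HB.instance Definition _ := gen_eqMixin cliff_term.
HB.instance Definition _ := gen_choiceMixin cliff_term.

Definition cliff_eqb : rel cliff_term := fun x y => `[< cliff_eq x y >].

Lemma cliff_eqb_refl : reflexive cliff_eqb.
Proof. by move=> x; apply/asboolP; apply: ce_refl. Qed.

Lemma cliff_eqb_sym : symmetric cliff_eqb.
Proof. by move=> x y; apply/asboolP/asboolP; apply: ce_sym. Qed.

Lemma cliff_eqb_trans : transitive cliff_eqb.
Proof.
by move=> y x z /asboolP xy /asboolP yz; apply/asboolP; apply: ce_trans yz.
Qed.

Canonical cliff_equiv :=
  EquivRel cliff_eqb cliff_eqb_refl cliff_eqb_sym cliff_eqb_trans.

Definition cliff := {eq_quot cliff_equiv}.

HB.instance Definition _ := Choice.on cliff.
HB.instance Definition _ := Quotient.on cliff.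
HB.instance Definition _ := EqQuotient.on cliff.

Lemma cliff_eqP x y : cliff_eq x y -> \pi_cliff x = \pi_cliff y.
Proof. by move=> xy; apply/eqmodP/asboolP. Qed.

Lemma cliff_piP x y : \pi_cliff x = \pi_cliff y -> cliff_eq x y.
Proof. by move/eqmodP/asboolP. Qed.

Lemma cliff_reprP x : cliff_eq (repr (\pi_cliff x)) x.
Proof. by apply: cliff_piP; rewrite reprK. Qed.

Definition cliff_const a : cliff := \pi_cliff (CConst a).
Definition cliff_addm (x y : cliff) : cliff :=
  \pi_cliff (CAdd (repr x) (repr y)).
Definition cliff_mulm (x y : cliff) : cliff :=
  \pi_cliff (CMul (repr x) (repr y)).
Definition cliff_oppm (x : cliff) : cliff := cliff_mulm (cliff_const (-1)) x.

Lemma cliff_addE x y :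
  cliff_addm (\pi_cliff x) (\pi_cliff y) = \pi_cliff (CAdd x y).
Proof. by apply: cliff_eqP; apply: ce_add; apply: cliff_reprP. Qed.

Lemma cliff_mulE x y :
  cliff_mulm (\pi_cliff x) (\pi_cliff y) = \pi_cliff (CMul x y).
Proof. by apply: cliff_eqP; apply: ce_mul; apply: cliff_reprP. Qed.

Fact cliff_addmA : associative cliff_addm.
Proof.
elim/quotW=> x; elim/quotW=> y; elim/quotW=> z.
rewrite (cliff_addE y z) (cliff_addE x y) !cliff_addE.
by apply: cliff_eqP; apply: ce_addA.
Qed.

Fact cliff_addmC : commutative cliff_addm.
Proof.
elim/quotW=> x; elim/quotW=> y; rewrite !cliff_addE.
by apply: cliff_eqP; apply: ce_addC.
Qed.

Fact cliff_add0m : left_id (cliff_const 0) cliff_addm.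
Proof. by elim/quotW=> x; rewrite ?cliff_addE ?cliff_mulE; apply: cliff_eqP; apply: ce_add0. Qed.

Fact cliff_addNm : left_inverse (cliff_const 0) cliff_oppm cliff_addm.
Proof. elim/quotW=> x; rewrite /cliff_oppm (cliff_mulE _ x) cliff_addE.
by apply: cliff_eqP; apply: ce_addN. Qed.

HB.instance Definition _ := GRing.isZmodule.Build cliff
  cliff_addmA cliff_addmC cliff_add0m cliff_addNm.

Fact cliff_mulmA : associative cliff_mulm.
Proof.
elim/quotW=> x; elim/quotW=> y; elim/quotW=> z.
rewrite (cliff_mulE y z) (cliff_mulE x y) !cliff_mulE.
by apply: cliff_eqP; apply: ce_mulA.
Qed.

Fact cliff_mul1m : left_id (cliff_const 1) cliff_mulm.
Proof. by elim/quotW=> x; rewrite ?cliff_addE ?cliff_mulE; apply: cliff_eqP; apply: ce_mul1. Qed.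

Fact cliff_constC a x : cliff_mulm (cliff_const a) x = cliff_mulm x (cliff_const a).
Proof.
by elim/quotW: x => x; rewrite ?cliff_addE ?cliff_mulE; apply: cliff_eqP; apply: ce_constC.
Qed.

Fact cliff_mulm1 : right_id (cliff_const 1) cliff_mulm.
Proof. by move=> x; rewrite -cliff_constC cliff_mul1m. Qed.

Fact cliff_mulmDl : left_distributive cliff_mulm +%R.
Proof.
elim/quotW=> x; elim/quotW=> y; elim/quotW=> z.
rewrite /GRing.add /= (cliff_addE x y) (cliff_mulE x z) (cliff_mulE y z).
by rewrite cliff_addE cliff_mulE; apply: cliff_eqP; apply: ce_mulDl.
Qed.

Fact cliff_mulmDr : right_distributive cliff_mulm +%R.
Proof.
elim/quotW=> x; elim/quotW=> y; elim/quotW=> z.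
rewrite /GRing.add /= (cliff_addE y z) (cliff_mulE x y) (cliff_mulE x z).
by rewrite cliff_addE cliff_mulE; apply: cliff_eqP; apply: ce_mulDr.
Qed.

HB.instance Definition _ := GRing.Zmodule_isPzRing.Build cliff
  cliff_mulmA cliff_mul1m cliff_mulm1 cliff_mulmDl cliff_mulmDr.

Definition cliff_scalem (a : F) (x : cliff) : cliff := cliff_mulm (cliff_const a) x.

Fact cliff_constD a b : cliff_const (a + b) = cliff_const a + cliff_const b.
Proof. by rewrite /GRing.add /= cliff_addE; apply: cliff_eqP; apply: ce_constD. Qed.

Fact cliff_constM a b : cliff_const (a * b) = cliff_const a * cliff_const b.
Proof. by rewrite [RHS]/GRing.mul /= cliff_mulE; apply: cliff_eqP; apply: ce_constM. Qed.

Fact cliff_scalemA a b x :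
  cliff_scalem a (cliff_scalem b x) = cliff_scalem (a * b) x.
Proof. by rewrite /cliff_scalem cliff_constM cliff_mulmA. Qed.

Fact cliff_scale1m : left_id 1 cliff_scalem.
Proof. exact: cliff_mul1m. Qed.

Fact cliff_scalemDr : right_distributive cliff_scalem +%R.
Proof. by move=> a x y; apply: cliff_mulmDr. Qed.

Fact cliff_scalemDl x : {morph cliff_scalem^~ x : a b / a + b}.
Proof. by move=> a b; rewrite /cliff_scalem cliff_constD cliff_mulmDl. Qed.

HB.instance Definition _ := GRing.Zmodule_isLmodule.Build F cliff
  cliff_scalemA cliff_scale1m cliff_scalemDr cliff_scalemDl.

Definition cliff_gen (v : V) : cliff := \pi_cliff (CGen v).

Lemma cliff_constE a : cliff_const a = a *: (1 : cliff).
Proof. by rewrite /GRing.scale /= /cliff_scalem cliff_mulm1. Qed.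

End CliffordTerms.

Section CliffordEval.
Variables (F : numFieldType) (V : vectType F) (B : {symmetric V}).
Variables (A : algType F) (f : V -> A).

Fixpoint cliff_eval (t : cliff_term V) : A :=
  match t with
  | CGen v => f v
  | CConst a => a%:A
  | CAdd x y => cliff_eval x + cliff_eval y
  | CMul x y => cliff_eval x * cliff_eval y
  end.

Definition cliff_compat := forall v w, f v * f w + f w * f v = (B v w)%:A.

Lemma cliff_eval_eq x y : linear f -> cliff_compat ->
  cliff_eq B x y -> cliff_eval x = cliff_eval y.
Proof.
move=> f_lin f_cliff; elim=> /= {x y}.
- by [].
- by move=> x y _ ->.
- by move=> x y z _ -> _ ->.
- by move=> x x' y y' _ -> _ ->.
- by move=> x x' y y' _ -> _ ->.
- by move=> x y z; rewrite addrA.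
- by move=> x y; rewrite addrC.
- by move=> x; rewrite scale0r add0r.
- by move=> x; rewrite mulr_algl scaleN1r addNr scale0r.
- by move=> x y z; rewrite mulrA.
- by move=> x; rewrite scale1r mul1r.
- by move=> x y z; rewrite mulrDl.
- by move=> x y z; rewrite mulrDr.
- by move=> a b; rewrite scalerDl.
- by move=> a b; rewrite mulr_algl scalerA.
- by move=> a x; rewrite mulr_algl mulr_algr.
- by move=> a v w; rewrite mulr_algl f_lin.
- by move=> v w; rewrite f_cliff.
Qed.

End CliffordEval.

(* Matrices satisfying the canonical anticommutation relations; they provide a
   nonzero algebra in which the Clifford relations hold. *)
Lemma CAR_exists (F : numFieldType) (d : nat) :
  exists (m : nat) (a c : 'I_d -> 'M[F]_m.+1),
    [/\ forall i j, a i * a j + a j * a i = 0,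
        forall i j, c i * c j + c j * c i = 0 &
        forall i j, a i * c j + c j * a i = (i == j)%:R].
Proof.
elim: d => [|d [m [a [c [aa cc ac]]]]].
  by exists 0, (fun=> 0), (fun=> 0); split=> [] [].
pose blk (p q r s : 'M[F]_m.+1) : 'M[F]_((m + m.+1).+1) :=
  (block_mx p q r s : 'M[F]_(m.+1 + m.+1)).
have bM p q r s p' q' r' s' : blk p q r s * blk p' q' r' s' =
    blk (p * p' + q * r') (p * q' + q * s') (r * p' + s * r') (r * q' + s * s').
  exact: (@mulmx_block _ m.+1 m.+1 m.+1 m.+1 m.+1 m.+1).
have bD p q r s p' q' r' s' : blk p q r s + blk p' q' r' s' =
    blk (p + p') (q + q') (r + r') (s + s').
  exact: (@add_block_mx _ m.+1 m.+1 m.+1 m.+1).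
have b1 : blk 1 0 0 1 = 1 by exact: (esym (@scalar_mx_block F m.+1 m.+1 1)).
have b0 : blk 0 0 0 0 = 0 by exact: (@block_mx0 _ m.+1 m.+1 m.+1 m.+1).
pose ext x0 (x : 'I_d -> 'M[F]_m.+1) (i : 'I_d.+1) :=
  if unlift ord0 i is Some i' then blk (x i') 0 0 (- x i') else x0.
exists (m + m.+1)%N, (ext (blk 0 1 0 0) a), (ext (blk 0 0 1 0) c).
split=> i j; rewrite /ext.
- case: (unliftP ord0 i) => [i' _|_]; case: (unliftP ord0 j) => [j' _|_];
  rewrite !bM bD ?(mul0r, mulr0, mul1r, mulr1, add0r, addr0, mulrN,
    mulNr, opprK, subrr, addNr) ?aa ?b0 //.
- case: (unliftP ord0 i) => [i' _|_]; case: (unliftP ord0 j) => [j' _|_];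
  by rewrite !bM bD ?(mul0r, mulr0, mul1r, mulr1, add0r, addr0, mulrN,
    mulNr, opprK, subrr, addNr) ?cc ?b0.
- case: (unliftP ord0 i) => [i' ->|->]; case: (unliftP ord0 j) => [j' ->|->];
  rewrite !bM bD ?(mul0r, mulr0, mul1r, mulr1, add0r, addr0, mulrN,
    mulNr, opprK, subrr, addNr) ?ac ?(inj_eq lift_inj) ?b0 ?eqxx ?b1 //.
  by case: eqP => _; rewrite ?b1 ?b0.
Qed.

Lemma cliff_rep_exists (F : numFieldType) (V : vectType F) (B : {symmetric V}) :
  exists (m : nat) (f : V -> 'M[F]_m.+1), linear f /\ cliff_compat B f.
Proof.
pose d := \dim (fullv : {vspace V}).
have [m [a [c [aa cc ac]]]] := CAR_exists F d.
pose e := vbasis (fullv : {vspace V}).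
pose f v : 'M[F]_m.+1 :=
  \sum_(i < d) (coord e i v *: c i + (2^-1 * B v e`_i) *: a i).
exists m, f; split=> [k v w|v w].
  rewrite /f scaler_sumr -big_split; apply: eq_bigr => i _ /=.
  rewrite linearP linearPl /= mulrDr !scalerDl scalerDr !scalerA.
  by rewrite [2^-1 * (k * _)]mulrCA addrACA.
have f2 v' w' : f v' * f w' = \sum_(i < d) \sum_(j < d)
    (coord e i v' *: c i + (2^-1 * B v' e`_i) *: a i) *
    (coord e j w' *: c j + (2^-1 * B w' e`_j) *: a j).
  by rewrite /f mulr_suml; apply: eq_bigr => i _; rewrite mulr_sumr.
have Bsum v' w' : \sum_(i < d) coord e i v' * B w' e`_i = B w' v'.
  rewrite [in RHS](coord_vbasis (memvf v')) linear_sum.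
  by apply: eq_bigr => i _ /=; rewrite linearZr.
rewrite !f2 [X in _ + X]exchange_big -big_split /=.
under eq_bigr => i _ do rewrite -big_split /=.
have term (i j : 'I_d) (p q p' q' : F) :
    (p *: c i + q *: a i) * (p' *: c j + q' *: a j) +
    (p' *: c j + q' *: a j) * (p *: c i + q *: a i) =
    ((p * q' + q * p') * (i == j)%:R)%:A.
  have scc (x : F) : x *: (c i * c j) + x *: (c j * c i) = 0.
    by rewrite -scalerDr cc scaler0.
  have saa (x : F) : x *: (a i * a j) + x *: (a j * a i) = 0.
    by rewrite -scalerDr aa scaler0.
  have sac (x : F) : x *: (a i * c j) + x *: (c j * a i) = (x * (i == j)%:R)%:A.
    by rewrite -scalerDr ac -scalerA scaler_nat.
  have sca (x : F) : x *: (c i * a j) + x *: (a j * c i) = (x * (i == j)%:R)%:A.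
    by rewrite -scalerDr addrC ac eq_sym -scalerA scaler_nat.
  rewrite !mulrDl !mulrDr -!scalerAl -!scalerAr !scalerA.
  rewrite (mulrC p' p) (mulrC q' p) (mulrC p' q) (mulrC q' q).
  rewrite scalerDl -sca -sac.
  rewrite -[RHS](addr0) -(saa (q * q')) -[RHS]addr0 -(scc (p * p')).
  rewrite (AC ((2*2)*(2*2)) ((2*7)*(3*6)*(4*8)*(1*5))) /=.
  by rewrite !addrA.
under eq_bigr => i _ do under eq_bigr => j _ do rewrite term.
under eq_bigr => i _.
  rewrite (bigD1 i) //= eqxx mulr1 big1 ?addr0; last first.
    by move=> j /negPf; rewrite eq_sym => ->; rewrite mulr0 scale0r.
  over.
rewrite /= -scaler_suml; congr (_ *: _).
under eq_bigr => i _ do rewrite mulrCA -mulrA -mulrDr [B v _ * _]mulrC.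
rewrite -mulr_sumr big_split /= !Bsum [B w v]hermC /= expr0 mul1r.
by rewrite -[B v w + _]mulr2n -[B v w *+ 2]mulr_natl mulrA mulVf ?mul1r // pnatr_eq0.
Qed.

Section CliffordAlgebra.
Variables (F : numFieldType) (V : vectType F) (B : {symmetric V}).
Local Notation Cl := (cliff B).

Fact cliff_oner_neq0 : (1 : Cl) != 0.
Proof.
have [m [f [f_lin f_cliff]]] := cliff_rep_exists B.
apply/eqP=> /(@cliff_piP _ _ B (CConst _ 1) (CConst _ 0)).
move/(cliff_eval_eq f_lin f_cliff) => /= /eqP.
by rewrite scale1r scale0r oner_eq0.
Qed.

HB.instance Definition _ :=
  GRing.PzSemiRing_isNonZero.Build Cl cliff_oner_neq0.

Fact cliff_scalerAl (a : F) (x y : Cl) : a *: (x * y) = a *: x * y.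
Proof. exact: cliff_mulmA. Qed.

HB.instance Definition _ := GRing.Lmodule_isLalgebra.Build F Cl cliff_scalerAl.

Fact cliff_scalerAr (a : F) (x y : Cl) : a *: (x * y) = x * (a *: y).
Proof.
rewrite [LHS](cliff_mulmA (cliff_const B a) x y) (cliff_constC a x).
by rewrite -cliff_mulmA.
Qed.

HB.instance Definition _ := GRing.Lalgebra_isAlgebra.Build F Cl cliff_scalerAr.

Fact cliff_gen_linear : linear (@cliff_gen F V B).
Proof.
move=> a v w; rewrite [LHS](cliff_eqP (ce_genP B a v w)).
by rewrite -cliff_addE -cliff_mulE.
Qed.

HB.instance Definition _ :=
  GRing.isLinear.Build F V Cl _ (@cliff_gen F V B) cliff_gen_linear.

Lemma cliff_genM v w :
  cliff_gen B v * cliff_gen B w + cliff_gen B w * cliff_gen B v = (B v w)%:A.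
Proof.
rewrite -cliff_constE -[RHS](cliff_eqP (ce_cliff B v w)).
by rewrite -cliff_addE -!cliff_mulE.
Qed.

Lemma cliff_ind (P : Cl -> Prop) :
    (forall v, P (cliff_gen B v)) -> (forall a, P a%:A) ->
    (forall x y, P x -> P y -> P (x + y)) ->
    (forall x y, P x -> P y -> P (x * y)) ->
  forall x, P x.
Proof.
move=> Pg Pc PD PM; elim/quotW; elim=> [v|a|x Px y Py|x Px y Py].
- exact: Pg.
- by rewrite -[\pi_ _ _]/(cliff_const B a) cliff_constE.
- by rewrite -cliff_addE; apply: PD.
- by rewrite -cliff_mulE; apply: PM.
Qed.

(* Universal property: a linear map satisfying the Clifford relations extends
   uniquely to a morphism of algebras. *)
Section Lift.
Variables (A : algType F) (f : {linear V -> A}).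

Definition cliff_lift (fB : cliff_compat B f) (x : Cl) : A :=
  cliff_eval f (repr x).

Variable fB : cliff_compat B f.

Let lift_pi t : cliff_lift fB (\pi_Cl t) = cliff_eval f t.
Proof.
apply: (cliff_eval_eq _ fB (cliff_reprP B t)).
by move=> a v w; rewrite linearP.
Qed.

Fact cliff_lift_linear : linear (cliff_lift fB).
Proof.
move=> a; elim/quotW=> x; elim/quotW=> y.
rewrite [a *: _](cliff_mulE B (CConst V a)).
rewrite [X in cliff_lift _ X]cliff_addE.
by rewrite !lift_pi /= mulr_algl.
Qed.

Fact cliff_lift_monoid_morphism : monoid_morphism (cliff_lift fB).
Proof.
split; first by rewrite [LHS]lift_pi /= scale1r.
elim/quotW=> x; elim/quotW=> y.
by rewrite [X in cliff_lift _ X]cliff_mulE !lift_pi.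
Qed.

HB.instance Definition _ := GRing.isLinear.Build F Cl A _ (cliff_lift fB)
  cliff_lift_linear.
HB.instance Definition _ := GRing.isMonoidMorphism.Build Cl A (cliff_lift fB)
  cliff_lift_monoid_morphism.

Lemma cliff_lift_gen v : cliff_lift fB (cliff_gen B v) = f v.
Proof. by rewrite /cliff_gen lift_pi. Qed.

End Lift.

Lemma cliff_lift_uniq (A : algType F) (g h : {lrmorphism Cl -> A}) :
  (forall v, g (cliff_gen B v) = h (cliff_gen B v)) -> g =1 h.
Proof.
move=> gh; elim/cliff_ind=> [//|a|x y gx gy|x y gx gy].
- by rewrite !linearZ !rmorph1.
- by rewrite !rmorphD /= gx gy.
- by rewrite !rmorphM /= gx gy.
Qed.

End CliffordAlgebra.

Section Superalgebra.
Variables (F : fieldType) (A : algType F) (part : bool -> A -> Prop).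

(* [part false] and [part true] are the even and the odd parts. *)
Record superalgebra : Prop := Superalgebra {
  super0 : forall b, part b 0;
  superP : forall b a x y, part b x -> part b y -> part b (a *: x + y);
  super_sum : forall x, exists x0 x1,
    [/\ part false x0, part true x1 & x = x0 + x1];
  super_direct : forall x, part false x -> part true x -> x = 0;
  super1 : part false 1;
  superM : forall b c x y, part b x -> part c y -> part (b (+) c) (x * y) }.

End Superalgebra.

Section CliffordParity.
Variables (F : numFieldType) (V : vectType F) (B : {symmetric V}).
Local Notation Cl := (cliff B).
Local Notation gen := (cliff_gen B).

(* [cliff_part b] is the span of the products of generators whose length has
   parity [b]. *)
Inductive cliff_part : bool -> Cl -> Prop :=
  | cliff_part1 : cliff_part false 1
  | cliff_part_gen b v x : cliff_part b x -> cliff_part (~~ b) (gen v * x)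
  | cliff_part0 b : cliff_part b 0
  | cliff_partP b a x y :
      cliff_part b x -> cliff_part b y -> cliff_part b (a *: x + y).

Fact cliff_parity_compat : cliff_compat B (-%R \o gen).
Proof. by move=> v w /=; rewrite !mulrNN cliff_genM. Qed.

Lemma cliff_superalgebra : superalgebra cliff_part.
Proof.
have partD b x y : cliff_part b x -> cliff_part b y -> cliff_part b (x + y).
  by move=> px py; rewrite -[x]scale1r; apply: cliff_partP.
have partZ b a x : cliff_part b x -> cliff_part b (a *: x).
  by move=> px; rewrite -[_ *: _]addr0; apply: cliff_partP => //; constructor.
have partM b c x y :
    cliff_part b x -> cliff_part c y -> cliff_part (b (+) c) (x * y).
  move=> px py; elim: px => {b x} [|b v x _ IH|b|b a x x' _ IH _ IH'].
  - by rewrite mul1r addFb.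
  - by rewrite -mulrA addNb; apply: cliff_part_gen.
  - by rewrite mul0r; constructor.
  - by rewrite mulrDl -scalerAl; apply: cliff_partP.
split.
- exact: cliff_part0.
- exact: cliff_partP.
- apply: cliff_ind => [v|a|x y [x0 [x1 [px0 px1 ->]]] [y0 [y1 [py0 py1 ->]]]
    |x y [x0 [x1 [px0 px1 ->]]] [y0 [y1 [py0 py1 ->]]]].
  + exists 0, (gen v); split; [by constructor| |by rewrite add0r].
    by rewrite -[gen v]mulr1; apply: (@cliff_part_gen false); constructor.
  + exists a%:A, 0; split; [|by constructor|by rewrite addr0].
    by apply: partZ; constructor.
  + exists (x0 + y0), (x1 + y1).
    by split; [apply: partD|apply: partD|rewrite addrACA].
  + exists (x0 * y0 + x1 * y1), (x0 * y1 + x1 * y0); split.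
    * apply: partD; first exact: (partM false false).
      exact: (partM true true).
    * apply: partD; first exact: (partM false true).
      exact: (partM true false).
    * rewrite mulrDl !mulrDr [x1 * y0 + _]addrC -!addrA; congr (_ + _).
      by rewrite addrCA.
- pose th : {lrmorphism Cl -> Cl} := cliff_lift cliff_parity_compat.
  have thP b x : cliff_part b x -> th x = (-1) ^+ b *: x.
    elim=> {b x} [|b v x _ IH|b|b a x y _ IHx _ IHy].
    + by rewrite scale1r rmorph1.
    + rewrite rmorphM /= cliff_lift_gen /= -/th IH -scalerAr signrN scaleNr.
      by rewrite mulNr scalerN.
    + by rewrite rmorph0 scaler0.
    + by rewrite linearP /= -/th IHx IHy scalerDr !scalerA mulrC.
  move=> x /thP + /thP; rewrite scale1r => ->.
  rewrite scaleN1r => /eqP; rewrite -addr_eq0 -mulr2n -scaler_nat.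
  by rewrite scaler_eq0 pnatr_eq0 => /eqP.
- exact: cliff_part1.
- exact: partM.
Qed.

End CliffordParity.

Record alg_action (F : fieldType) (A : algType F) (W : finGroupType) :=
  AlgAction {
    act_fun :> W -> {lrmorphism A -> A};
    act_fun1 : act_fun 1%g =1 id;
    act_funM : forall u v, act_fun (u * v)%g =1 act_fun u \o act_fun v }.

Section Smash.
Variables (F : fieldType) (A : algType F) (W : finGroupType).

(* The underlying vector space is that of A (x) F[W]: [x] stands for the sum
   of the [x w * w].  The product is determined by w a = (act w a) w. *)
Definition smash of alg_action A W := {ffun W -> A}.

Variable act : alg_action A W.
Local Notation S := (smash act).

HB.instance Definition _ := GRing.Lmodule.copy S {ffun W -> A}.

Definition smash_one : S := [ffun w => (w == 1%g)%:R].
Definition smash_mul (x y : S) : S :=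
  [ffun w => \sum_(u : W) x u * act u (y (u^-1 * w)%g)].

Fact smash_mulA : associative smash_mul.
Proof.
move=> x y z; apply/ffunP=> w; rewrite !ffunE.
under eq_bigr => u _ do rewrite ffunE rmorph_sum mulr_sumr /=.
under [RHS]eq_bigr => u _ do rewrite ffunE mulr_suml.
rewrite [RHS]exchange_big /=; apply: eq_bigr => u _.
rewrite [RHS](reindex_inj (mulgI u)) /=; apply: eq_bigr => v _.
by rewrite rmorphM /= mulKg invMg act_funM !mulrA /= mulgA.
Qed.

Fact smash_mul1 : left_id smash_one smash_mul.
Proof.
move=> x; apply/ffunP=> w; rewrite ffunE (bigD1 1%g) //= ffunE eqxx mul1r.
rewrite act_fun1 invg1 mul1g big1 ?addr0 // => u /negPf nu.
by rewrite ffunE nu mul0r.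
Qed.

Fact smash_mulr1 : right_id smash_one smash_mul.
Proof.
move=> x; apply/ffunP=> w; rewrite ffunE (bigD1 w) //= ffunE mulVg eqxx.
rewrite rmorph1 mulr1 big1 ?addr0 // => u /negPf nu.
by rewrite ffunE -eq_invg_mul invgK nu rmorph0 mulr0.
Qed.

Fact smash_mulDl : left_distributive smash_mul +%R.
Proof.
move=> x y z; apply/ffunP=> w; rewrite !ffunE -big_split /=.
by apply: eq_bigr => u _; rewrite !ffunE mulrDl.
Qed.

Fact smash_mulDr : right_distributive smash_mul +%R.
Proof.
move=> x y z; apply/ffunP=> w; rewrite !ffunE -big_split /=.
by apply: eq_bigr => u _; rewrite !ffunE rmorphD mulrDr.
Qed.

Fact smash_one_neq0 : smash_one != 0.
Proof.
apply/eqP=> /ffunP/(_ 1%g)/eqP.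
by rewrite !ffunE eqxx oner_eq0.
Qed.

HB.instance Definition _ := GRing.Zmodule_isNzRing.Build S
  smash_mulA smash_mul1 smash_mulr1 smash_mulDl smash_mulDr smash_one_neq0.

Fact smash_scalerAl (a : F) (x y : S) : a *: (x * y) = a *: x * y.
Proof.
apply/ffunP=> w; rewrite !ffunE scaler_sumr; apply: eq_bigr => u _.
by rewrite !ffunE scalerAl.
Qed.

HB.instance Definition _ :=
  GRing.Lmodule_isLalgebra.Build F S smash_scalerAl.

Fact smash_scalerAr (a : F) (x y : S) : a *: (x * y) = x * (a *: y).
Proof.
apply/ffunP=> w; rewrite !ffunE scaler_sumr; apply: eq_bigr => u _.
by rewrite !ffunE linearZ /= scalerAr.
Qed.

HB.instance Definition _ :=
  GRing.Lalgebra_isAlgebra.Build F S smash_scalerAr.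

Definition smash_elt (a : A) (w : W) : S := [ffun u => a *+ (u == w)].

Definition smash_alg (a : A) : S := smash_elt a 1%g.
Definition smash_grp (w : W) : S := smash_elt 1 w.

Lemma smash_eltM a u b v :
  smash_elt a u * smash_elt b v = smash_elt (a * act u b) (u * v)%g.
Proof.
apply/ffunP=> w; rewrite !ffunE (bigD1 u) //= !ffunE eqxx mulr1n.
rewrite big1 ?addr0 => [|t /negPf nt]; last by rewrite ffunE nt mul0r.
by rewrite raddfMn /= mulrnAr -(inj_eq (mulgI u)) mulKVg.
Qed.

Lemma smash_eltE a w : smash_elt a w = smash_alg a * smash_grp w.
Proof. by rewrite smash_eltM mul1g rmorph1 mulr1. Qed.

Lemma smash_grpM u v : smash_grp (u * v)%g = smash_grp u * smash_grp v.
Proof. by rewrite smash_eltM rmorph1 mulr1. Qed.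

Lemma smash_grp1 : smash_grp 1%g = 1.
Proof. by apply/ffunP=> w; rewrite !ffunE. Qed.

Lemma smash_rel w a : smash_grp w * smash_alg a = smash_alg (act w a) * smash_grp w.
Proof. by rewrite !smash_eltM mul1g mulg1 !mul1r rmorph1 mulr1. Qed.

Lemma smash_sumE (x : S) : x = \sum_w smash_alg (x w) * smash_grp w.
Proof.
apply/ffunP=> w; rewrite sum_ffunE (bigD1 w) //= -smash_eltE ffunE eqxx.
rewrite big1 ?addr0 // => u; rewrite eq_sym => /negPf nu.
by rewrite -smash_eltE ffunE nu.
Qed.

Fact smash_alg_linear : linear smash_alg.
Proof. by move=> a x y; apply/ffunP=> w; rewrite !ffunE mulrnDl scalerMnr. Qed.

Fact smash_alg_monoid_morphism : monoid_morphism smash_alg.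
Proof.
by split=> [|x y]; [rewrite -smash_grp1 | rewrite smash_eltM act_fun1 mulg1].
Qed.

HB.instance Definition _ :=
  GRing.isLinear.Build F A S _ smash_alg smash_alg_linear.
HB.instance Definition _ :=
  GRing.isMonoidMorphism.Build A S smash_alg smash_alg_monoid_morphism.

(* The elements of W are even, whence the condition on coefficients only. *)
Definition smash_part (part : bool -> A -> Prop) (b : bool) (x : S) : Prop :=
  forall w, part b (x w).

Lemma smash_superalgebra (part : bool -> A -> Prop) :
  superalgebra part ->
  (forall w b a, part b a -> part b (act w a)) ->
  superalgebra (smash_part part).
Proof.
move=> [s0 sP sS sD s1 sM] sact.
have sDD b x y : part b x -> part b y -> part b (x + y).
  by move=> px py; rewrite -[x]scale1r; apply: sP.
split.
- by move=> b w; rewrite ffunE.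
- by move=> b a x y px py w; rewrite !ffunE; apply: sP.
- move=> x.
  have /choice [g gP] : forall w, exists p : A * A,
      [/\ part false p.1, part true p.2 & x w = p.1 + p.2].
    by move=> w; have [x0 [x1 H]] := sS (x w); exists (x0, x1).
  exists [ffun w => (g w).1], [ffun w => (g w).2]; split.
  + by move=> w; rewrite ffunE; have [] := gP w.
  + by move=> w; rewrite ffunE; have [] := gP w.
  + by apply/ffunP=> w; rewrite !ffunE; have [] := gP w.
- by move=> x p0 p1; apply/ffunP=> w; rewrite ffunE; apply: sD.
- by move=> w; rewrite ffunE; case: eqP => _; [apply: s1 | apply: s0].
- move=> b c x y px py w; rewrite ffunE.
  by elim/big_rec: _ => [|u z _ pz]; [apply: s0 | apply/sDD/pz/sM/sact].
Qed.

End Smash.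

Section TensorGroup.
Variables (F : fieldType) (A : algType F) (W : finGroupType).

Definition triv_action : alg_action A W :=
  @AlgAction F A W (fun _ => idfun) (frefl _) (fun _ _ => frefl _).

(* A (x) F[W], where a (x) w is [smash_elt triv_action a w]. *)
Definition tensor_grp := smash triv_action.

HB.instance Definition _ := GRing.Algebra.on tensor_grp.

Lemma tensor_grpC w a :
  smash_grp triv_action w * smash_alg triv_action a =
  smash_alg triv_action a * smash_grp triv_action w.
Proof. exact: smash_rel. Qed.

End TensorGroup.

Definition grp_alg (F : fieldType) (W : finGroupType) := tensor_grp F^o W.

HB.instance Definition _ (F : fieldType) (W : finGroupType) :=
  GRing.Algebra.on (grp_alg F W).

(* [tensor_grp A W] is the tensor product of the algebras A and F[W]: pure
   tensors are multiplied factorwise and form a universal bilinear map. *)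
Section TensorUniversal.
Variables (F : fieldType) (A : algType F) (W : finGroupType).

Definition tensor_pure (a : A) (x : grp_alg F W) : tensor_grp A W :=
  [ffun w => (x w : F) *: a].

Lemma tensor_pureE a w :
  tensor_pure a (smash_grp (triv_action F^o W) w) =
  smash_elt (triv_action A W) a w.
Proof.
by apply/ffunP=> u; rewrite !ffunE; case: eqP; rewrite ?scale1r ?scale0r.
Qed.

Lemma tensor_pureM a b x y :
  tensor_pure a x * tensor_pure b y = tensor_pure (a * b) (x * y).
Proof.
apply/ffunP=> w; rewrite !ffunE scaler_suml; apply: eq_bigr => u _.
by rewrite !ffunE /= -scalerAl -scalerAr scalerA.
Qed.

Lemma tensor_pure_bilinear :
  (forall x, linear (tensor_pure^~ x)) /\ (forall a, linear (tensor_pure a)).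
Proof.
split=> [x c a b|a c x y]; apply/ffunP=> w; rewrite !ffunE.
  by rewrite scalerDr !scalerA mulrC.
by rewrite scalerDl scalerA.
Qed.

Lemma tensor_universal (U : lmodType F) (f : A -> grp_alg F W -> U) :
    (forall x, linear (f^~ x)) -> (forall a, linear (f a)) ->
  exists g : {linear tensor_grp A W -> U},
    (forall a x, g (tensor_pure a x) = f a x) /\
    (forall h : {linear tensor_grp A W -> U},
       (forall a x, h (tensor_pure a x) = f a x) -> h =1 g).
Proof.
move=> fl fr; pose e w := smash_grp (triv_action F^o W) w.
pose fL x : {linear A -> U} :=
  HB.pack (f^~ x) (GRing.isLinear.Build F A U _ (f^~ x) (fl x)).
pose fR a : {linear grp_alg F W -> U} :=
  HB.pack (f a) (GRing.isLinear.Build F (grp_alg F W) U _ (f a) (fr a)).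
pose g (t : tensor_grp A W) : U := \sum_w f (t w) (e w).
have g_lin : linear g.
  move=> c s t; rewrite /g scaler_sumr -big_split /=; apply: eq_bigr => w _.
  by rewrite !ffunE fl.
pose gL : {linear tensor_grp A W -> U} :=
  HB.pack g (GRing.isLinear.Build F (tensor_grp A W) U _ g g_lin).
exists gL.
have xE (x : grp_alg F W) : x = \sum_w (x w : F) *: e w.
  rewrite [LHS]smash_sumE; apply: eq_bigr => w _; rewrite -smash_eltE.
  apply/ffunP=> u; rewrite !ffunE; case: eqP => _; last by rewrite scaler0.
  exact: (esym (mulr1 _)).
have tE (t : tensor_grp A W) : t = \sum_w tensor_pure (t w) (e w).
  by rewrite [LHS]smash_sumE; apply: eq_bigr => w _; rewrite tensor_pureE -smash_eltE.
split=> [a x|h hE t] /=.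
  rewrite /g [in RHS](xE x) -[RHS]/(fR a _) linear_sum; apply: eq_bigr => w _.
  by rewrite ffunE -[LHS]/(fL (e w) _) !linearZ.
by rewrite [in LHS](tE t) linear_sum; apply: eq_bigr => w _; rewrite hE.
Qed.

End TensorUniversal.

Section SymmetricBuild.
Variables (F : fieldType) (V : lmodType F) (f : V -> V -> F).
Hypothesis f_lin : forall z a x y, f (a *: x + y) z = a * f x z + f y z.
Hypothesis f_sym : forall x y, f x y = f y x.

Let zl z : zmod_morphism (f ^~ z).
Proof. by move=> x y; rewrite addrC -scaleN1r f_lin mulN1r addrC. Qed.

Let zr z : zmod_morphism (f z).
Proof. by move=> x y; rewrite f_sym zl !(f_sym z). Qed.

Let f0 z : f 0 z = 0.
Proof. by rewrite -(subrr 0) zl subrr. Qed.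

Let sl z : scalable_for ( *%R : F -> F -> F) (f ^~ z).
Proof. by move=> a x; rewrite -[a *: x]addr0 f_lin f0 addr0. Qed.

Let sr z : scalable_for (idfun \; *%R : F -> F -> F) (f z).
Proof. by move=> a x; rewrite f_sym sl f_sym. Qed.

Definition symmetric_bilinear :=
  @isBilinear.Build F V V F ( *%R ) (idfun \; *%R) f zl zr sl sr.

Let hf x y : f x y = (-1) ^+ false * idfun (f y x).
Proof. by rewrite mul1r f_sym. Qed.

Definition symmetric_hermitian :=
  @isHermitianSesquilinear.Build F V false idfun f hf.

End SymmetricBuild.

Section DualForm.
Variables (F : fieldType) (V : vectType F) (B : {symmetric V}).
Local Notation V' := 'Hom(V, F^o).

Lemma sym_formC x y : B x y = B y x.
Proof. by rewrite hermC expr0 mul1r. Qed.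

(* The map V -> V', x |-> B(x, -), and its inverse (when B is nondegenerate). *)
Definition form_flat : 'Hom(V, V') :=
  linfun (fun x : V => linfun (fun y : V => B x y : F^o) : V').
Definition form_sharp : 'Hom(V', V) := (form_flat^-1)%VF.

Lemma form_flatE x y : form_flat x y = B x y.
Proof.
pose g x : {linear V -> F^o} := HB.pack (fun y : V => B x y : F^o)
  (GRing.isLinear.Build F V F^o _ (fun y : V => B x y : F^o)
     (fun a u v => linearPr B x a u v)).
have g_lin : linear (fun x => linfun (g x) : V').
  move=> a u v; apply/lfunP=> w; rewrite add_lfunE scale_lfunE !lfunE /=.
  exact: linearPl.
pose h : {linear V -> V'} := HB.pack (fun x => linfun (g x) : V')
  (GRing.isLinear.Build F V V' _ (fun x => linfun (g x) : V') g_lin).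
rewrite /form_flat -[X in linfun X]/(h : V -> V').
rewrite (lfunE h) /=.
by rewrite (lfunE (g x)).
Qed.

Definition dual_form (f g : V') : F := B (form_sharp f) (form_sharp g).

Fact dual_form_linear h a f g :
  dual_form (a *: f + g) h = a * dual_form f h + dual_form g h.
Proof. by rewrite /dual_form linearP linearPl. Qed.

Fact dual_form_sym f g : dual_form f g = dual_form g f.
Proof. exact: sym_formC. Qed.

HB.instance Definition _ := symmetric_bilinear dual_form_linear dual_form_sym.
HB.instance Definition _ := symmetric_hermitian dual_form_sym.

End DualForm.

Section SumForm.
Variables (F : fieldType) (V1 V2 : vectType F).
Variables (B1 : {symmetric V1}) (B2 : {symmetric V2}).

Definition sum_form (x y : V1 * V2) : F := B1 x.1 y.1 + B2 x.2 y.2.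

Fact sum_form_linear z a x y :
  sum_form (a *: x + y) z = a * sum_form x z + sum_form y z.
Proof. by rewrite /sum_form /= !linearPl /= mulrDr addrACA. Qed.

Fact sum_form_sym x y : sum_form x y = sum_form y x.
Proof. by rewrite /sum_form sym_formC [B2 _ _]sym_formC. Qed.

HB.instance Definition _ := symmetric_bilinear sum_form_linear sum_form_sym.
HB.instance Definition _ := symmetric_hermitian sum_form_sym.

End SumForm.

Record orth_rep (F : fieldType) (W : finGroupType) := OrthRep {
  or_space : vectType F;
  or_form : {symmetric or_space};
  or_act : W -> 'End(or_space);
  or_act1 : or_act 1%g = \1%VF;
  or_actM : forall u v, or_act (u * v)%g = (or_act u \o or_act v)%VF;
  or_inv : forall w x y, or_form (or_act w x) (or_act w y) = or_form x y;
  or_nondeg : forall x, (forall y, or_form x y = 0) -> x = 0 }.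

Section DoubleClifford.
Variables (F : numFieldType) (W : finGroupType) (M : orth_rep F W).
Local Notation V := (or_space M).
Local Notation V' := 'Hom(V, F^o).
Local Notation B := (or_form M).
Local Notation rho := (or_act M).

Definition double_act (w : W) (x : V * V') : V * V' :=
  (rho w x.1, (x.2 \o rho w^-1)%VF).

Fact double_act_linear w : linear (double_act w).
Proof.
move=> a x y; congr pair; rewrite /= ?linearP //.
by rewrite comp_lfunDl comp_lfunZl.
Qed.

HB.instance Definition _ w := GRing.isLinear.Build F (V * V')%type (V * V')%type _
  (double_act w) (double_act_linear w).

Definition double_form : {symmetric (V * V')%type} :=
  sum_form B (dual_form B).

Lemma or_actK w : cancel (rho w) (rho w^-1).
Proof. by move=> x; rewrite -comp_lfunE -or_actM mulVg or_act1 id_lfunE. Qed.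

Lemma form_flat_inj : lker (form_flat B) == 0%VS.
Proof.
apply/lker0P=> x y xy; apply/eqP; rewrite -subr_eq0; apply/eqP/or_nondeg=> z.
by rewrite -form_flatE linearB /= xy subrr zero_lfunE.
Qed.

Lemma form_flatK : cancel (form_flat B) (form_sharp B).
Proof. exact: lker0_lfunK form_flat_inj. Qed.

Lemma form_sharpK : cancel (form_sharp B) (form_flat B).
Proof.
move=> f; apply: limg_lfunVK.
suff -> : limg (form_flat B) = fullv by apply: memvf.
apply/eqP; rewrite eqEdim subvf /= limg_dim_eq; last first.
  by rewrite (eqP form_flat_inj) capv0.
by rewrite !dimvf /= /dim /= muln1.
Qed.

Lemma form_sharp_act w f :
  form_sharp B (f \o rho w^-1)%VF = rho w (form_sharp B f).
Proof.
rewrite -[RHS]form_flatK; congr (form_sharp B _); apply/lfunP=> y.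
rewrite comp_lfunE form_flatE -[y in RHS](or_actK w^-1) invgK or_inv.
by rewrite -form_flatE form_sharpK.
Qed.

Lemma double_act_isometry w x y :
  double_form (double_act w x) (double_act w y) = double_form x y.
Proof.
rewrite /double_form /= /sum_form /= or_inv /dual_form.
by rewrite !form_sharp_act or_inv.
Qed.

Lemma double_act1 x : double_act 1%g x = x.
Proof.
by case: x => x f; rewrite /double_act /= invg1 or_act1 id_lfunE comp_lfun1r.
Qed.

Lemma double_actM u v x : double_act (u * v)%g x = double_act u (double_act v x).
Proof.
case: x => x f; rewrite /double_act /= invMg !or_actM comp_lfunE.
by rewrite comp_lfunA.
Qed.

Definition double_cliff := cliff double_form.

HB.instance Definition _ := GRing.Algebra.on double_cliff.

Fact cliff_act_compat w : cliff_compat double_form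
  (cliff_gen double_form \o double_act w).
Proof. by move=> x y; rewrite /= cliff_genM double_act_isometry. Qed.

Definition cliff_act_fun (w : W) : {lrmorphism double_cliff -> double_cliff} :=
  cliff_lift (cliff_act_compat w).

Lemma cliff_act_gen w x :
  cliff_act_fun w (cliff_gen double_form x) =
  cliff_gen double_form (double_act w x).
Proof. exact: cliff_lift_gen. Qed.

Fact cliff_act_fun1 : cliff_act_fun 1%g =1 id.
Proof.
apply: (@cliff_lift_uniq _ _ _ _ (cliff_act_fun 1%g) idfun) => x.
by rewrite cliff_act_gen double_act1.
Qed.

Fact cliff_act_funM u v :
  cliff_act_fun (u * v)%g =1 cliff_act_fun u \o cliff_act_fun v.
Proof.
apply: (@cliff_lift_uniq _ _ _ _ (cliff_act_fun (u * v)%g)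
  (cliff_act_fun u \o cliff_act_fun v)) => x.
by rewrite /= 3!cliff_act_gen double_actM.
Qed.

Definition cliff_act : alg_action double_cliff W :=
  AlgAction cliff_act_fun1 cliff_act_funM.

Lemma cliff_act_part w b x :
  cliff_part b x -> cliff_part b (cliff_act w x).
Proof.
elim=> {b x} [|b v x _ IH|b|b a x y _ IHx _ IHy].
- by rewrite rmorph1; constructor.
- by rewrite rmorphM /= cliff_act_gen; constructor.
- by rewrite rmorph0; constructor.
- by rewrite linearP; apply: cliff_partP.
Qed.

End DoubleClifford.

Section StandardForm.
Variables (F : fieldType) (N : nat).

Definition std_form (x y : 'rV[F]_N) : F := \sum_(i < N) x 0 i * y 0 i.

Fact std_form_linear z a x y :
  std_form (a *: x + y) z = a * std_form x z + std_form y z.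
Proof.
rewrite /std_form mulr_sumr -big_split; apply: eq_bigr => i _ /=.
by rewrite !mxE mulrDl mulrA.
Qed.

Fact std_form_sym x y : std_form x y = std_form y x.
Proof. by apply: eq_bigr => i _; rewrite mulrC. Qed.

HB.instance Definition _ := symmetric_bilinear std_form_linear std_form_sym.
HB.instance Definition _ := symmetric_hermitian std_form_sym.

Definition reflection (a x : 'rV[F]_N) : 'rV[F]_N :=
  x - (2 * std_form a x / std_form a a) *: a.

Lemma reflection_isometry a x y :
  std_form (reflection a x) (reflection a y) = std_form x y.
Proof.
have subl u v z : std_form (u - v) z = std_form u z - std_form v z.
  by rewrite linearBl.
have subr u v z : std_form z (u - v) = std_form z u - std_form z v.
  by rewrite linearBr.
have scl c u v : std_form (c *: u) v = c * std_form u v by rewrite linearZl_LR.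
have scr c u v : std_form v (c *: u) = c * std_form v u by rewrite linearZr_LR.
rewrite /reflection !(subl, subr, scl, scr) [std_form x a]std_form_sym.
have [aa|aa] := eqVneq (std_form a a) 0; last by field.
by rewrite aa invr0 !(mulr0, mul0r, subr0).
Qed.

Variable U : {vspace 'rV[F]_N}.

Definition sub_form (x y : subvs_of U) : F := std_form (vsval x) (vsval y).

Fact sub_form_linear z a x y :
  sub_form (a *: x + y) z = a * sub_form x z + sub_form y z.
Proof. by rewrite /sub_form linearP linearPl. Qed.

Fact sub_form_sym x y : sub_form x y = sub_form y x.
Proof. exact: std_form_sym. Qed.

HB.instance Definition _ := symmetric_bilinear sub_form_linear sub_form_sym.
HB.instance Definition _ := symmetric_hermitian sub_form_sym.

End StandardForm.

Section RootSystems.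
Variables (R : realType) (N : nat).

Definition cplx (v : 'rV[R]_N) : 'rV[R[i]]_N := map_mx (real_complex R) v.

(* [Phi] lists a reduced crystallographic root system in its span. *)
Record root_system (Phi : seq 'rV[R]_N) : Prop := RootSystem {
  root_neq0 : 0 \notin Phi;
  root_refl : {in Phi &, forall a b, reflection a b \in Phi};
  root_int : {in Phi &, forall a b,
    2 * std_form a b / std_form a a \is a Num.int};
  root_reduced : forall a c, a \in Phi -> c *: a \in Phi -> c = 1 \/ c = -1 }.

Definition irreducible_roots (Phi : seq 'rV[R]_N) : Prop :=
  Phi != [::] /\
  forall P : pred 'rV[R]_N,
    {in Phi &, forall a b, P a -> ~~ P b -> std_form a b = 0} ->
    {in Phi, forall a, P a} \/ {in Phi, forall a, ~~ P a}.

Definition root_base (Phi : seq 'rV[R]_N) n (alpha : 'I_n -> 'rV[R]_N) : Prop :=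
  [/\ forall i, alpha i \in Phi,
      free [seq alpha i | i : 'I_n] &
      {in Phi, forall b, exists c : 'I_n -> nat,
        b = \sum_i alpha i *+ c i \/ b = - \sum_i alpha i *+ c i}].

(* [alpha] is a base of an irreducible root system and h^* is the complex span
   of the roots: the Weyl group of a complex simple Lie algebra. *)
Definition simple_type n (alpha : 'I_n -> 'rV[R]_N)
    (hd : {vspace 'rV[R[i]]_N}) : Prop :=
  exists Phi, [/\ root_system Phi, irreducible_roots Phi, root_base Phi alpha &
    hd = <<[seq cplx a | a <- Phi]>>%VS].

(* gl_N: alpha_i = e_i - e_{i+1} and h^* is all of C^N. *)
Definition gl_type n (alpha : 'I_n -> 'rV[R]_N)
    (hd : {vspace 'rV[R[i]]_N}) : Prop :=
  [/\ N = n.+1,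
      forall i (k : 'I_N), alpha i 0 k = (k == i :> nat)%:R - (k == i.+1 :> nat)%:R
    & hd = fullv].

Lemma std_form_conj_eq0 (x : 'rV[R[i]]_N) :
  std_form x (map_mx conjc x) = 0 -> x = 0.
Proof.
have E (z : R[i]) : z * conjc z = (complex.Re z ^+ 2 + complex.Im z ^+ 2)%:C%C.
  by case: z => a b; simpc; rewrite /= -!expr2 [b * a]mulrC addNr.
rewrite /std_form; under eq_bigr => i _ do rewrite mxE E.
rewrite -rmorph_sum => /(@complexI R)/eqP.
rewrite psumr_eq0 => [/allP x0|i _]; last by rewrite addr_ge0 ?sqr_ge0.
apply/rowP=> i; rewrite mxE.
have := x0 i (mem_index_enum i); rewrite paddr_eq0 ?sqr_ge0 //.
by rewrite !sqrf_eq0; case: (x 0 i) => a b /= /andP[/eqP-> /eqP->].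
Qed.

Lemma std_form_sub_nondeg n (alpha : 'I_n -> 'rV[R]_N) hd (x : subvs_of hd) :
  simple_type alpha hd \/ gl_type alpha hd ->
  (forall y, sub_form x y = 0) -> x = 0.
Proof.
move=> hT x0; apply: val_inj; rewrite /= ?linear0.
suff cx : map_mx conjc (vsval x) \in hd.
  apply: std_form_conj_eq0.
  by have := x0 (Subvs cx).
case: hT (vsval x) (subvsP x) => [[Phi [_ _ _ ->]]|[_ _ ->]] v; last by rewrite !memvf.
set X := [seq cplx a | a <- Phi].
move/(@coord_span _ _ _ (in_tuple X)) ->.
rewrite raddf_sum memv_suml // => i _ /=.
have -> : map_mx conjc (coord (in_tuple X) i v *: X`_i) =
    conjc (coord (in_tuple X) i v) *: X`_i.
  have /mapP[a _ ->] : X`_i \in X by apply: mem_nth; apply: ltn_ord.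
  apply/rowP=> k; rewrite !mxE rmorphM; congr (_ * _).
  exact: conjc_real.
by rewrite memvZ // memv_span // mem_nth.
Qed.

End RootSystems.

(* C is R[i].  [wd_hdual] is h^*, realized in C^(wd_dim) and carrying the
   restriction of the standard form.  The Weyl group is given as an abstract
   finite group, identified by [wd_act] with the group of automorphisms of h^*
   generated by the simple reflections. *)
Record weyl_datum (R : realType) := WeylDatum {
  wd_dim : nat;
  wd_rank : nat;
  wd_root : 'I_wd_rank -> 'rV[R]_wd_dim;
  wd_hdual : {vspace 'rV[R[i]]_wd_dim};
  wd_type : simple_type wd_root wd_hdual \/ gl_type wd_root wd_hdual;
  wd_group : finGroupType;
  wd_s : 'I_wd_rank -> wd_group;
  wd_act : wd_group -> 'End(subvs_of wd_hdual);
  wd_act1 : wd_act 1%g = \1%VF;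
  wd_actM : forall u v, wd_act (u * v)%g = (wd_act u \o wd_act v)%VF;
  wd_act_inj : injective wd_act;
  wd_act_s : forall i x,
    vsval (wd_act (wd_s i) x) = reflection (cplx (wd_root i)) (vsval x);
  wd_gen : <<[set wd_s i | i : 'I_wd_rank]>>%g = [set: wd_group] }.

Section WeylRep.
Variables (R : realType) (D : weyl_datum R).

Lemma wd_act_isometry (w : wd_group D) x y :
  sub_form (wd_act w x) (wd_act w y) = sub_form x y.
Proof.
pose H := [set w : wd_group D | `[< forall x y,
  sub_form (wd_act w x) (wd_act w y) = sub_form x y >]].
have gH : group_set H.
  apply/group_setP; split=> [|u v].
    by rewrite inE; apply/asboolP => ? ?; rewrite wd_act1 !id_lfunE.
  rewrite !inE => /asboolP Hu /asboolP Hv; apply/asboolP=> a b.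
  by rewrite wd_actM !comp_lfunE Hu Hv.
suff : w \in Group gH by rewrite inE => /asboolP.
apply: (subsetP _ w (in_setT w)); rewrite -wd_gen gen_subG.
apply/subsetP=> _ /imsetP[i _ ->]; rewrite inE; apply/asboolP=> a b.
by rewrite /sub_form !wd_act_s reflection_isometry.
Qed.

(* [or_space wd_rep] is h^*. *)
Definition wd_rep : orth_rep R[i] (wd_group D) :=
  @OrthRep R[i] (wd_group D) (subvs_of (wd_hdual D)) (@sub_form _ _ _)
    (@wd_act R D) (wd_act1 D) (@wd_actM R D) wd_act_isometry
    (fun x => @std_form_sub_nondeg R _ _ _ _ x (wd_type D)).

End WeylRep.

Section WeylAlgebras.
Variables (R : realType) (D : weyl_datum R).
Local Notation M := (wd_rep D).
Local Notation hdual := (or_space M).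
Local Notation h := 'Hom(or_space M, R[i]^o).

Definition weyl_cliff := double_cliff M.
HB.instance Definition _ := GRing.Algebra.on weyl_cliff.

Definition weyl_smash := smash (cliff_act M).
HB.instance Definition _ := GRing.Algebra.on weyl_smash.

Definition weyl_tensor := tensor_grp weyl_cliff (wd_group D).
HB.instance Definition _ := GRing.Algebra.on weyl_tensor.

Definition cliff_hdual (x : hdual) : weyl_cliff :=
  cliff_gen (double_form M) (x, 0).
Definition cliff_h (f : h) : weyl_cliff := cliff_gen (double_form M) (0, f).

Definition smash_of_cliff (a : weyl_cliff) : weyl_smash := smash_alg _ a.
Definition smash_of_grp (w : wd_group D) : weyl_smash := smash_grp _ w.
Definition tensor_of_cliff (a : weyl_cliff) : weyl_tensor := smash_alg _ a.
Definition tensor_of_grp (w : wd_group D) : weyl_tensor := smash_grp _ w.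

Definition weyl_smash_part (b : bool) (x : weyl_smash) : Prop :=
  smash_part (act := cliff_act M) (@cliff_part _ _ (double_form M)) b x.
Definition weyl_tensor_part (b : bool) (x : weyl_tensor) : Prop :=
  smash_part (act := triv_action weyl_cliff _) (@cliff_part _ _ (double_form M)) b x.

Lemma weyl_smash_superalgebra : superalgebra weyl_smash_part.
Proof.
apply: smash_superalgebra (cliff_superalgebra _) _ => w b a.
exact: cliff_act_part.
Qed.

Lemma weyl_tensor_superalgebra : superalgebra weyl_tensor_part.
Proof. exact: smash_superalgebra (cliff_superalgebra _) _. Qed.

(* The positive multiple of the simple root alpha_i of square length 2, as an
   element of h^*, and the element of h corresponding to it. *)
Definition wd_beta (i : 'I_(wd_rank D)) : hdual :=
  vsproj (wd_hdual D)
    (cplx (Num.sqrt (2 / std_form (wd_root i) (wd_root i)) *: wd_root i)).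
Definition wd_nu (i : 'I_(wd_rank D)) : h := form_flat (or_form M) (wd_beta i).

Lemma wd_root_neq0 (i : 'I_(wd_rank D)) : wd_root i != 0.
Proof.
case: (wd_type D) => [[Phi [[P0 _ _ _] _ [aP _ _] _]]|[N1 aE _]].
  by apply: contraNneq P0 => <-.
have lti : (i < wd_dim D)%N by rewrite N1 ltnS ltnW.
apply/eqP=> /rowP/(_ (Ordinal lti)); rewrite aE mxE /= eqxx.
by rewrite ltn_eqF // subr0; apply/eqP/oner_neq0.
Qed.

Lemma wd_root_mem c (i : 'I_(wd_rank D)) : cplx (c *: wd_root i) \in wd_hdual D.
Proof.
have -> : cplx (c *: wd_root i) = c%:C%C *: cplx (wd_root i).
  by apply/rowP=> k; rewrite !mxE rmorphM.
apply: memvZ; case: (wd_type D) => [[Phi [_ _ [aP _ _] ->]]|[_ _ ->]].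
  by apply: memv_span; apply: map_f.
exact: memvf.
Qed.

Lemma wd_beta_norm i : or_form M (wd_beta i) (wd_beta i) = 2.
Proof.
rewrite /= /sub_form vsprojK ?wd_root_mem // /std_form.
under eq_bigr => k _ do rewrite !mxE -rmorphM.
rewrite -rmorph_sum; have -> : \sum_k (Num.sqrt (2 / std_form (wd_root i) (wd_root i)) * wd_root i 0 k *
   (Num.sqrt (2 / std_form (wd_root i) (wd_root i)) * wd_root i 0 k)) = 2.
  set d := std_form _ _.
  have d_gt0 : 0 < d.
    rewrite lt0r sumr_ge0 => [|k _]; last by rewrite -expr2 sqr_ge0.
    rewrite andbT; apply: contra (wd_root_neq0 i).
    rewrite psumr_eq0 => [/allP z|k _]; last by rewrite -expr2 sqr_ge0.
    apply/eqP/rowP=> k; have := z k (mem_index_enum k).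
    by rewrite -expr2 sqrf_eq0 mxE => /eqP.
  under eq_bigr => k _ do rewrite mulrACA -expr2.
  rewrite -mulr_sumr sqr_sqrtr ?divr_ge0 ?ler0n ?ltW //.
  by rewrite -/(std_form (wd_root i) (wd_root i)) -/d divfK ?gt_eqF.
by rewrite rmorph_nat.
Qed.

Lemma cliff_beta2 i : cliff_hdual (wd_beta i) ^+ 2 = 1.
Proof.
have E : double_form M (wd_beta i, 0) (wd_beta i, 0) = 2.
  rewrite -[LHS]/(or_form M (wd_beta i) (wd_beta i) +
    or_form M (form_sharp (or_form M) 0) (form_sharp (or_form M) 0)).
  by rewrite wd_beta_norm [form_sharp _ 0]raddf0 linear0r addr0.
have := cliff_genM (double_form M) (wd_beta i, 0) (wd_beta i, 0).
rewrite E -mulr2n -scaler_nat => /(congr1 (fun x => 2^-1 *: x)).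
by rewrite !scalerA mulVf ?pnatr_eq0 // !scale1r.
Qed.

End WeylAlgebras.

Definition superalgebra_iso (F : fieldType) (A B : algType F)
    (pA : bool -> A -> Prop) (pB : bool -> B -> Prop)
    (f : {lrmorphism A -> B}) (g : {lrmorphism B -> A}) : Prop :=
  [/\ cancel f g, cancel g f,
      forall b x, pA b x -> pB b (f x) & forall b y, pB b y -> pA b (g y)].

(* Main.v *)
Require Import Defs.
From HB Require Import structures.
From mathcomp Require Import all_boot all_order all_fingroup all_algebra.
From mathcomp Require Import complex.
From mathcomp Require Import boolp reals.
From mathcomp Require Import ring.

Set Implicit Arguments.
Unset Strict Implicit.
Unset Printing Implicit Defensive.

Import Order.TTheory GRing.Theory Num.Theory.

Local Open Scope ring_scope.

(** The two algebras differ only in how W acts on the Clifford algebra Cl, so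
it suffices to make that action inner in a multiplicative way: to find even
elements c_w of Cl with c_u c_v = c_(uv) and c_w a = a^w c_w.  Then
a w |-> a c_w w is a morphism from the smash product to the tensor product,
and a w |-> a c_(w^-1) w is its inverse.  Since c_s = sqrt(-1) beta nu squares
to 1 at a simple reflection s, both maps send s to c_s s.

The elements c_s act by conjugation as the reflections, so a product of them
along a word of simple reflections implements the product of the word.  What
must be shown is that it depends on the product only.  Over C the form on
h^* + h splits, Cl acts on the exterior algebra of h^*, and W acts on
that space by algebra automorphisms; c_w is this operator, and it fixes the
vacuum 1.  To avoid
both the Fock space and the Coxeter relations, the vacuum is taken inside Cl:
it is the product of the annihilators x - sqrt(-1) nu_x, with x running over a
basis of h^* and nu_x the counterpart of x in h.  An element c_w is then
characterized by c_w a = a^w c_w together with c_w vacuum = vacuum.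

Uniqueness ([spin_lift_uniq]) is the heart of the matter.  The difference z of
two candidates satisfies z a = a^w z and z vacuum = 0; bracketing with the
creators x + sqrt(-1) nu_x strips the annihilators from the product one at a
time, whence z = 0 ([ann_prod_faithful]).  Both conditions are stable under
products, so uniqueness gives c_u c_v = c_(uv), and existence is needed only
on generators ([spin_lift_reflection]). *)

(** * Untwisting an action by inner automorphisms *)

Section Untwisting.
Variables (F : fieldType) (A : algType F) (W : finGroupType).
Variables (act : alg_action A W) (c : W -> A).
Hypothesis c1 : c 1%g = 1.
Hypothesis cM : forall u v, c (u * v)%g = c u * c v.
Hypothesis c_act : forall w a, c w * a = act w a * c w.

Lemma lift_mulV w : c w * c w^-1 = 1.
Proof. by rewrite -cM mulgV. Qed.

Lemma lift_mulVl w : c w^-1 * c w = 1.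
Proof. by rewrite -cM mulVg. Qed.

Definition untwist (x : smash act) : tensor_grp A W := [ffun w => x w * c w].
Definition retwist (y : tensor_grp A W) : smash act := [ffun w => y w * c w^-1].

Lemma untwistK : cancel untwist retwist.
Proof. by move=> x; apply/ffunP=> w; rewrite !ffunE -mulrA lift_mulV mulr1. Qed.

Lemma retwistK : cancel retwist untwist.
Proof. by move=> x; apply/ffunP=> w; rewrite !ffunE -mulrA lift_mulVl mulr1. Qed.

Fact untwist_linear : linear untwist.
Proof.
by move=> a x y; apply/ffunP=> w; rewrite !ffunE mulrDl scalerAl.
Qed.

Fact untwist_monoid_morphism : monoid_morphism untwist.
Proof.
split=> [|x y]; apply/ffunP=> w; rewrite !ffunE.
  by case: eqP => [->|_]; rewrite ?c1 ?mulr1 ?mul0r.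
rewrite mulr_suml; apply: eq_bigr => u _; rewrite !ffunE /=.
by rewrite -!mulrA; congr (_ * _); rewrite mulrA c_act -mulrA -cM mulKVg.
Qed.

Fact retwist_linear : linear retwist.
Proof.
by move=> a x y; apply: (can_inj untwistK); rewrite untwist_linear !retwistK.
Qed.

Fact retwist_monoid_morphism : monoid_morphism retwist.
Proof.
have [u1 uM] := untwist_monoid_morphism.
split=> [|x y]; apply: (can_inj untwistK); first by rewrite u1 retwistK.
by rewrite uM !retwistK.
Qed.

Definition untwist_morphism : {lrmorphism smash act -> tensor_grp A W} :=
  HB.pack untwist
    (GRing.isLinear.Build F (smash act) (tensor_grp A W) _ untwist
       untwist_linear)
    (GRing.isMonoidMorphism.Build (smash act) (tensor_grp A W) untwist
       untwist_monoid_morphism).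

Definition retwist_morphism : {lrmorphism tensor_grp A W -> smash act} :=
  HB.pack retwist
    (GRing.isLinear.Build F (tensor_grp A W) (smash act) _ retwist
       retwist_linear)
    (GRing.isMonoidMorphism.Build (tensor_grp A W) (smash act) retwist
       retwist_monoid_morphism).

Lemma untwist_elt a w :
  untwist (smash_elt act a w) = smash_elt (triv_action A W) (a * c w) w.
Proof.
by apply/ffunP=> u; rewrite !ffunE; case: eqP => [->|_] //; rewrite mul0r.
Qed.

Lemma retwist_elt a w :
  retwist (smash_elt (triv_action A W) a w) = smash_elt act (a * c w^-1) w.
Proof.
by apply/ffunP=> u; rewrite !ffunE; case: eqP => [->|_] //; rewrite mul0r.
Qed.

End Untwisting.

(** * The vacuum of a doubled Clifford algebra *)

Section SpinLift.
Variables (F : numFieldType) (W : finGroupType) (M : orth_rep F W).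
Variables (j : F) (jj : j * j = -1).
Local Notation V := (or_space M).
Local Notation B := (or_form M).
Local Notation Cl := (double_cliff M).
Local Notation gen := (cliff_gen (double_form M)).
Local Notation "x ^+- y" := (x * y + y * x) (at level 30).

Definition gen_l (x : V) : Cl := gen (x, 0).
Definition gen_r (x : V) : Cl := gen (0, form_flat B x).

Fact gen_l_linear : linear gen_l.
Proof.
move=> a x y; rewrite /gen_l -[LHS]/(gen _) -linearP; congr gen.
by congr pair; rewrite /= scaler0 addr0.
Qed.

Fact gen_r_linear : linear gen_r.
Proof.
move=> a x y; rewrite /gen_r -linearP; congr gen.
by congr pair; rewrite /= ?scaler0 ?addr0 // linearP.
Qed.

HB.instance Definition _ := GRing.isLinear.Build F V Cl _ gen_l gen_l_linear.
HB.instance Definition _ := GRing.isLinear.Build F V Cl _ gen_r gen_r_linear.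

(** As [form_flat] is invertible, the two copies of V generate Cl; this lets
the whole argument use V alone, without linear forms on it. *)
Lemma genE x : gen x = gen_l x.1 + gen_r (form_sharp B x.2).
Proof.
rewrite /gen_l /gen_r form_sharpK -linearD; congr gen; case: x => x f.
by congr pair; rewrite /= ?addr0 ?add0r.
Qed.

Lemma gen_ll x y : gen_l x ^+- gen_l y = (B x y)%:A.
Proof.
rewrite cliff_genM; congr (_ *: _); rewrite -[LHS]/(B x y + B _ _).
by rewrite [form_sharp _ 0]raddf0 linear0r addr0.
Qed.

Lemma gen_rr x y : gen_r x ^+- gen_r y = (B x y)%:A.
Proof.
rewrite cliff_genM; congr (_ *: _); rewrite -[LHS]/(B 0 0 + B _ _).
by rewrite !form_flatK linear0r add0r.
Qed.

Lemma gen_lr x y : gen_l x ^+- gen_r y = 0.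
Proof.
rewrite cliff_genM -[X in X *: _]/(B x 0 + B _ _) /=.
by rewrite [form_sharp _ 0]raddf0 linear0l linear0r addr0 scale0r.
Qed.

Lemma act_gen_l w x : cliff_act M w (gen_l x) = gen_l (or_act M w x).
Proof.
by rewrite [LHS]cliff_act_gen; congr gen; congr pair; rewrite /= comp_lfun0l.
Qed.

Lemma act_gen_r w x : cliff_act M w (gen_r x) = gen_r (or_act M w x).
Proof.
rewrite [LHS]cliff_act_gen; congr gen; congr pair; rewrite /= ?linear0 //.
by rewrite -[LHS]form_sharpK form_sharp_act form_flatK.
Qed.

(** x + k nu_x, defined as a single generator so that all anticommutators come
from one evaluation of the form.  For k = - j these are the annihilators, which
span an isotropic subspace; for k = j, the creators, dual to them. *)
Definition twisted_gen (k : F) (x : V) : Cl := gen (x, k *: form_flat B x).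

Fact twisted_gen_linear k : linear (twisted_gen k).
Proof.
move=> a x y; rewrite /twisted_gen -linearP; congr gen; congr pair => //=.
by rewrite linearP scalerDr !scalerA mulrC.
Qed.

HB.instance Definition _ k :=
  GRing.isLinear.Build F V Cl _ (twisted_gen k) (twisted_gen_linear k).

Lemma sharp_flatZ k x : form_sharp B (k *: form_flat B x) = k *: x.
Proof. by rewrite -[RHS]form_flatK; congr (form_sharp B _); rewrite linearZ. Qed.

Lemma twisted_genE k x : twisted_gen k x = gen_l x + k *: gen_r x.
Proof. by rewrite [LHS]genE sharp_flatZ linearZ. Qed.

Lemma twisted_gen_anticomm k l x y :
  twisted_gen k x ^+- twisted_gen l y = ((1 + k * l) * B x y)%:A.
Proof.
rewrite cliff_genM; congr (_ *: _); rewrite -[LHS]/(B x y + B _ _) /=.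
by rewrite !sharp_flatZ linearZl_LR linearZr_LR /= mulrDl mul1r mulrA.
Qed.

Local Notation ann := (twisted_gen (- j)).
Local Notation cre := (twisted_gen j).

Lemma ann_anticomm x y : ann x * ann y = - (ann y * ann x).
Proof.
apply/eqP; rewrite -addr_eq0 twisted_gen_anticomm mulrNN jj subrr mul0r.
by rewrite scale0r.
Qed.

Lemma cre_ann x y : cre x ^+- ann y = (2 * B x y)%:A.
Proof. by rewrite twisted_gen_anticomm mulrN jj opprK. Qed.

Local Notation e := (vbasis (fullv : {vspace V})).
Local Notation d := (\dim (fullv : {vspace V})).

Definition ann_prod (s : seq 'I_d) : Cl := \prod_(k <- s) ann e`_k.
Definition vacuum := ann_prod (index_enum 'I_d).

(** An annihilator can be moved next to its own copy in the product, and it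
squares to zero. *)
Lemma ann_ann_prod (s : seq 'I_d) k : k \in s -> ann e`_k * ann_prod s = 0.
Proof.
rewrite /ann_prod; elim: s => // l s IH; rewrite in_cons big_cons mulrA.
have [<-{l} _|_ /= /IH ks] := eqVneq k l; last first.
  by rewrite ann_anticomm mulNr -mulrA ks mulr0 oppr0.
suff -> : ann e`_k * ann e`_k = 0 by rewrite mul0r.
apply/eqP; have /eqP := ann_anticomm e`_k e`_k.
by rewrite -addr_eq0 -mulr2n -scaler_nat scaler_eq0 pnatr_eq0.
Qed.

Lemma ann_vacuum x : ann x * vacuum = 0.
Proof.
rewrite (coord_vbasis (memvf x)) linear_sum mulr_suml big1 // => k _.
by rewrite linearZ -scalerAl ann_ann_prod ?mem_index_enum // scaler0.
Qed.

(** A creator orthogonal to all the factors anticommutes with each of them. *)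
Lemma ann_prod_cre (s : seq 'I_d) y : (forall k, k \in s -> B y e`_k = 0) ->
  ann_prod s * cre y = (-1) ^+ size s *: (cre y * ann_prod s).
Proof.
rewrite /ann_prod; elim: s => [_|k s IH ys].
  by rewrite big_nil mul1r mulr1 scale1r.
rewrite big_cons -mulrA IH => [|l ls]; last by rewrite ys // in_cons ls orbT.
have /eqP := cre_ann y e`_k; rewrite ys ?mem_head // mulr0 scale0r.
rewrite addrC addr_eq0 => /eqP ak.
by rewrite -scalerAr !mulrA ak mulNr scalerN /= exprS mulN1r scaleNr.
Qed.

(** * Elements implementing the group action *)

Definition intertwines w (p : Cl) := forall a, p * a = cliff_act M w a * p.

(** Let a be the first factor, P the product of the others, and C the creator
dual to a, so that C a + a C = 2.  Then z a P = 0 gives z C a P = 0, because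
z C = C^w z, and z a C P = 0, because C passes through P up to a sign.  The two
add up to 2 z P = 0, so the factor a can be removed. *)
Lemma ann_prod_faithful w z (s : seq 'I_d) :
  intertwines w z -> uniq s -> z * ann_prod s = 0 -> z = 0.
Proof.
move=> zw; elim: s => [_|k s IH /= /andP[ks us]].
  by rewrite /ann_prod big_nil mulr1.
rewrite /ann_prod big_cons -/(ann_prod s) => z0; apply: IH us _.
pose y := form_sharp B (linfun (coord e k : V -> F^o)).
have yE (l : 'I_d) : B y e`_l = (k == l)%:R.
  rewrite -form_flatE form_sharpK lfunE /=.
  by rewrite (coord_free _ _ (basis_free (vbasisP _))) eq_sym.
have /(congr1 (fun c => z * c * ann_prod s)) := cre_ann y e`_k.
rewrite yE eqxx mulr1 mulrDr mulrDl.
have -> : z * (cre y * ann e`_k) * ann_prod s = 0.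
  by rewrite mulrA zw -!mulrA z0 mulr0.
have -> : z * (ann e`_k * cre y) * ann_prod s = 0.
  have /(congr1 (fun c => (-1) ^+ size s *: c)) :
      ann_prod s * cre y = (-1) ^+ size s *: (cre y * ann_prod s).
    by apply: ann_prod_cre => l ls; rewrite yE; case: eqP ls ks => [->->|].
  (* The same sign moves the creator back to the right end, behind z a P. *)
  rewrite scalerA -expr2 sqrr_sign scale1r => E.
  by rewrite -!mulrA -E -!scalerAr !mulrA -(mulrA z) z0 mul0r scaler0.
rewrite addr0 => /esym/eqP; rewrite mulr_algr -scalerAl scaler_eq0 pnatr_eq0 /=.
by move/eqP.
Qed.

(** The action determines p only up to a scalar; fixing the vacuum normalizes
it, which turns a projective lift of W into a linear one. *)
Record spin_lift w (p : Cl) : Prop := SpinLift {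
  spin_even : cliff_part false p;
  spin_intertwines : intertwines w p;
  spin_vacuum : p * vacuum = vacuum }.

Lemma spin_lift_uniq w p q : spin_lift w p -> spin_lift w q -> p = q.
Proof.
move=> [_ pw pv] [_ qw qv]; apply/eqP; rewrite -subr_eq0; apply/eqP.
apply: (@ann_prod_faithful w _ (index_enum 'I_d)).
- by move=> a; rewrite mulrBl pw qw mulrBr.
- exact: index_enum_uniq.
- by rewrite -/vacuum mulrBl pv qv subrr.
Qed.

Lemma spin_lift1 : spin_lift 1%g 1.
Proof.
split; [by constructor| |by rewrite mul1r].
by move=> a; rewrite mul1r mulr1 cliff_act_fun1.
Qed.

Lemma spin_liftM u v p q :
  spin_lift u p -> spin_lift v q -> spin_lift (u * v)%g (p * q).
Proof.
move=> [pe pu pv] [qe qv qv']; split.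
- exact: (superM (cliff_superalgebra _) pe qe).
- by move=> a; rewrite -mulrA qv mulrA pu cliff_act_funM mulrA.
- by rewrite -mulrA qv' pv.
Qed.

Lemma intertwines_gen w p :
    (forall x, p * gen_l x = gen_l (or_act M w x) * p) ->
    (forall x, p * gen_r x = gen_r (or_act M w x) * p) ->
  intertwines w p.
Proof.
move=> pl pr; elim/cliff_ind => [x|a|x y px py|x y px py].
- rewrite genE mulrDr pl pr -mulrDl -act_gen_l -act_gen_r; congr (_ * _).
  exact: (esym (rmorphD (cliff_act M w) _ _)).
- by rewrite [X in _ = X * _](rmorph_alg (cliff_act M w)) mulr_algr mulr_algl.
- by rewrite mulrDr px py rmorphD mulrDl.
- by rewrite mulrA px -mulrA py rmorphM mulrA.
Qed.

(** * The lift of a reflection *)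

Section Reflection.
Variable b : V.
Hypothesis bb : B b b = 2.
Local Notation L := (gen_l b).
Local Notation N := (gen_r b).

Let half (x : Cl) : x * x + x * x = 2%:A -> x * x = 1.
Proof.
rewrite -mulr2n -scaler_nat => /(congr1 (fun c => 2^-1 *: c)).
by rewrite !scalerA mulVf ?pnatr_eq0 // !scale1r.
Qed.

Let LL : L * L = 1. Proof. by apply: half; rewrite gen_ll bb. Qed.
Let NN : N * N = 1. Proof. by apply: half; rewrite gen_rr bb. Qed.

Let NL x : N * gen_l x = - (gen_l x * N).
Proof. by apply/eqP; rewrite -addr_eq0 addrC gen_lr. Qed.

Let LR x : L * gen_r x = - (gen_r x * L).
Proof. by apply/eqP; rewrite -addr_eq0 gen_lr. Qed.

Let Ll x : L * gen_l x = (B b x)%:A - gen_l x * L.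
Proof. by rewrite -gen_ll addrK. Qed.

Let Nr x : N * gen_r x = (B b x)%:A - gen_r x * N.
Proof. by rewrite -gen_rr addrK. Qed.

Lemma reflection_elt_sq : j *: (L * N) * (j *: (L * N)) = 1.
Proof.
rewrite -scalerAl -scalerAr scalerA jj scaleN1r -mulrA [N * _]mulrA NL.
by rewrite mulNr mulrN opprK -mulrA NN mulr1.
Qed.

(** A generator orthogonal to b anticommutes with both L and N, hence commutes
with L N, while L and N themselves anticommute with L N: conjugation by L N is
the reflection on both copies of V.  The vacuum is fixed because the
annihilator L - j N kills it, so L may be replaced by j N next to it. *)
Lemma spin_lift_reflection s : (forall x, or_act M s x = x - B b x *: b) ->
  spin_lift s (j *: (L * N)).
Proof.
move=> sE; split.
- rewrite -[_ *: _]addr0; apply: cliff_partP; last by constructor.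
  apply: (@cliff_part_gen _ _ _ true); rewrite -[N]mulr1.
  by apply: (@cliff_part_gen _ _ _ false); constructor.
- apply: intertwines_gen => x; rewrite sE -scalerAl -scalerAr; congr (_ *: _).
    rewrite linearB linearZ /= -mulrA NL mulrN mulrA Ll mulrBl mulr_algl.
    by rewrite opprB mulrBl -scalerAl !mulrA LL mul1r.
  rewrite linearB linearZ /= -mulrA Nr mulrBr mulr_algr mulrA (LR x).
  rewrite mulNr opprK mulrBl -scalerAl [N * (L * N)]mulrA NL mulNr -!mulrA NN.
  by rewrite mulr1 scalerN opprK addrC mulrA.
- have /eqP := ann_vacuum b; rewrite twisted_genE scaleNr mulrBl.
  rewrite subr_eq0 -scalerAl => /eqP Lv.
  have LN : - (N * L) = L * N by rewrite NL opprK.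
  rewrite -scalerAl -LN mulNr -mulrA Lv -scalerAr mulrA NN mul1r.
  by rewrite scalerN scalerA jj scaleN1r opprK.
Qed.

End Reflection.

(** The elements of W that have a lift form a subgroup, which contains the
generators; uniqueness makes the choice of lifts multiplicative. *)
Lemma spin_lift_morphism_exists (I : finType) (s : I -> W) (b : I -> V) :
    <<[set s i | i : I]>>%g = [set: W] -> (forall i, B (b i) (b i) = 2) ->
    (forall i x, or_act M (s i) x = x - B (b i) x *: b i) ->
  exists c : W -> Cl, [/\ c 1%g = 1, {morph c : u v / (u * v)%g >-> u * v},
    forall w, intertwines w (c w), forall w, cliff_part false (c w) &
    forall i, c (s i) = j *: (gen_l (b i) * gen_r (b i))].
Proof.
move=> sgen bb sE; have sl i := spin_lift_reflection (bb i) (sE i).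
pose H := [set w | `[< exists p, spin_lift w p >]].
have gH : group_set H.
  apply/group_setP; split=> [|u v].
    by rewrite inE; apply/asboolP; exists 1; apply: spin_lift1.
  rewrite !inE => /asboolP[p up] /asboolP[q vq].
  by apply/asboolP; exists (p * q); apply: spin_liftM.
have /choice[c cP] w : exists p, spin_lift w p.
  suff : w \in Group gH by rewrite inE => /asboolP.
  apply: (subsetP _ w (in_setT w)); rewrite -sgen gen_subG.
  apply/subsetP=> _ /imsetP[i _ ->]; rewrite inE; apply/asboolP.
  by eexists; apply: sl.
exists c; split.
- exact: spin_lift_uniq (cP _) spin_lift1.
- by move=> u v; apply: spin_lift_uniq (cP _) (spin_liftM (cP u) (cP v)).
- by move=> w; have [] := cP w.
- by move=> w; have [] := cP w.
- by move=> i; apply: spin_lift_uniq (cP _) (sl i).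
Qed.

End SpinLift.

(** * Weyl groups *)

Lemma reflection_rescaled (F : numFieldType) N (k : F) (a x : 'rV[F]_N) :
  std_form (k *: a) (k *: a) = 2 ->
  reflection a x = x - std_form (k *: a) x *: (k *: a).
Proof.
have Zl (u v : 'rV[F]_N) : std_form (k *: u) v = k * std_form u v.
  by rewrite linearZl_LR.
rewrite Zl std_form_sym !Zl => aa2; rewrite /reflection scalerA; congr (_ - _ *: _).
have aa0 : std_form a a != 0.
  by apply: contra_eq_neq aa2 => ->; rewrite !mulr0 eq_sym pnatr_eq0.
by apply: (mulIf aa0); rewrite divfK // -aa2; ring.
Qed.

Lemma wd_act_beta (R : realType) (D : weyl_datum R) i (x : or_space (wd_rep D)) :
  or_act (wd_rep D) (wd_s i) x =
  x - or_form (wd_rep D) (wd_beta i) x *: wd_beta i.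
Proof.
set k := (Num.sqrt (2 / std_form (wd_root i) (wd_root i)))%:C%C.
have vbE : vsval (wd_beta i) = k *: cplx (wd_root i).
  rewrite vsprojK ?wd_root_mem //.
  by apply/rowP=> l; rewrite !mxE rmorphM.
have bb : std_form (k *: cplx (wd_root i)) (k *: cplx (wd_root i)) = 2.
  by rewrite -vbE; apply: wd_beta_norm.
apply: val_inj; rewrite [LHS]wd_act_s (reflection_rescaled _ bb) -vbE.
by rewrite [RHS]linearB [X in _ = _ - X]linearZ.
Qed.

Theorem theorem2p6 (R : realType) (D : weyl_datum R) :
  exists (Phi : {lrmorphism weyl_smash D -> weyl_tensor D})
         (Psi : {lrmorphism weyl_tensor D -> weyl_smash D}),
    [/\ superalgebra_iso (@weyl_smash_part R D) (@weyl_tensor_part R D) Phi Psi,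
        forall a : weyl_cliff D, Phi (smash_of_cliff a) = tensor_of_cliff a,
        forall i : 'I_(wd_rank D),
          Phi (smash_of_grp (wd_s i)) =
          ('i%C : R[i]) *:
            (tensor_of_cliff (cliff_hdual (wd_beta i) * cliff_h (wd_nu i)) *
             tensor_of_grp (wd_s i)),
        forall a : weyl_cliff D, Psi (tensor_of_cliff a) = smash_of_cliff a &
        forall i : 'I_(wd_rank D),
          Psi (tensor_of_grp (wd_s i)) =
          ('i%C : R[i]) *:
            (smash_of_cliff (cliff_hdual (wd_beta i) * cliff_h (wd_nu i)) *
             smash_of_grp (wd_s i))].
Proof.
have ii : ('i%C : R[i]) * 'i%C = -1 by rewrite -expr2 sqr_i.
have [c [c1 cM c_act c_even cs]] :=
  spin_lift_morphism_exists ii (wd_gen D) (@wd_beta_norm R D) (@wd_act_beta R D).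
pose Phi : {lrmorphism weyl_smash D -> weyl_tensor D} := untwist_morphism c1 cM c_act.
pose Psi : {lrmorphism weyl_tensor D -> weyl_smash D} := retwist_morphism c1 cM c_act.
have even_mulr b (a : weyl_cliff D) w : cliff_part b a -> cliff_part b (a * c w).
  by move=> /(superM (cliff_superalgebra _))/(_ (c_even w)); rewrite addbF.
(* Psi involves the inverse of s_i, whose lift is that of s_i. *)
have csV i : c (wd_s i)^-1%g = c (wd_s i).
  have cs2 : c (wd_s i) * c (wd_s i) = 1.
    by rewrite cs; apply: reflection_elt_sq ii _ (wd_beta_norm i).
  by rewrite -[LHS]mul1r -cs2 -mulrA -cM mulgV c1 mulr1.
exists Phi, Psi; split.
- split; [exact: untwistK|exact: retwistK| |].
  + by move=> b x xb w; rewrite ffunE; apply/even_mulr/xb.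
  + by move=> b x xb w; rewrite ffunE; apply/even_mulr/xb.
- by move=> a; rewrite [LHS]untwist_elt c1 mulr1.
- move=> i; rewrite [LHS]untwist_elt mul1r cs smash_eltE linearZ /=.
  by rewrite -scalerAl.
- by move=> a; rewrite [LHS]retwist_elt invg1 c1 mulr1.
- move=> i; rewrite [LHS]retwist_elt mul1r csV cs smash_eltE linearZ /=.
  by rewrite -scalerAl.
Qed.
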